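(* Let $G$ be a finitely generated group and let $H\le G$ be a finitely generated subgroup. If $H$ has no Morse elements of its own (i.e. no element of $H$ is Morse in the group $H$ endowed with its own word metric), then $H$ contains no Morse elements of $G$.
   Context: A bi-infinite quasi-geodesic $\mathfrak q$ in a metric space is called Morse if for every $L\ge 1$, $C\ge 0$ there is $M=M(L,C)$ such that every $(L,C)$-quasi-geodesic with endpoints on the image of $\mathfrak q$ is contained in the $M$-tubular neighborhood of $\mathfrak q$. An element $h$ of a finitely generated group $\Gamma$ is called a Morse element of $\Gamma$ if $(h^n)_{n\in\mathbb Z}$ is a Morse (bi-infinite) quasi-geodesic in (a Cayley graph of) $\Gamma$; this does not depend on the choice of the finite generating set. *)

(* Defs.v *)
From mathcomp Require Import all_boot all_order all_algebra.
From mathcomp Require Import all_classical all_reals.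

Set Implicit Arguments.
Unset Strict Implicit.
Unset Printing Implicit Defensive.
Import Order.TTheory GRing.Theory Num.Theory.
Local Open Scope classical_set_scope.
Local Open Scope ring_scope.

(* A metric on X is passed as its distance function d : X -> X -> R.          *)

Definition quasi_isometric_on (R : realType) (X Y : Type)
    (dX : X -> X -> R) (dY : Y -> Y -> R) (A : set X) (L C : R)
    (f : X -> Y) : Prop :=
  forall s t : X, A s -> A t ->
    L^-1 * dX s t - C <= dY (f s) (f t) <= L * dX s t + C.

(* Only the values of p on [a, b] matter; p need not be continuous.           *)
Definition quasi_geodesic (R : realType) (X : Type) (d : X -> X -> R)
    (L C a b : R) (p : R -> X) : Prop :=
  a <= b /\ quasi_isometric_on (fun s t : R => `|s - t|) d `[a, b] L C p.

(* Bi-infinite quasi-geodesics are indexed by the integers, as (h ^ n)_n is.  *)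
Definition bi_infinite_quasi_geodesic (R : realType) (X : Type)
    (d : X -> X -> R) (q : int -> X) : Prop :=
  exists L C : R, [/\ 1 <= L, 0 <= C &
    quasi_isometric_on (fun m n : int => `|m - n|%:~R) d setT L C q].

Definition tubular_neighborhood (R : realType) (X : Type) (d : X -> X -> R)
    (A : set X) (M : R) : set X :=
  [set x | exists2 y, A y & d x y <= M].

Definition morse_quasi_geodesic (R : realType) (X : Type) (d : X -> X -> R)
    (q : int -> X) : Prop :=
  bi_infinite_quasi_geodesic d q /\
  forall L C : R, 1 <= L -> 0 <= C ->
    exists M : R, forall (a b : R) (p : R -> X),
      quasi_geodesic d L C a b p -> range q (p a) -> range q (p b) ->
      p @` `[a, b] `<=` tubular_neighborhood d (range q) M.

(* Words in the letters of S and their inverses that evaluate to g.           *)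
Definition words_for (G : groupType) (S : seq G) (g : G) : set (seq G) :=
  [set w | all [pred x | (x \in S) || (x^-1 \in S)%g] w /\
           (\prod_(x <- w) x = g)%g].

Definition generates (G : groupType) (S : seq G) : Prop :=
  forall g : G, words_for S g !=set0.

(* When S generates G the infimum is a minimum: it is taken over a nonempty   *)
(* set of natural numbers.                                                    *)
Definition word_length (R : realType) (G : groupType) (S : seq G) (g : G) : R :=
  inf [set (size w)%:R | w in words_for S g].

(* The distance between vertices of the Cayley graph of G with respect to S.  *)
Definition word_metric (R : realType) (G : groupType) (S : seq G)
    (x y : G) : R :=
  word_length R S (x^-1 * y)%g.

Definition expgz (G : groupType) (h : G) (n : int) : G :=
  match n with
  | Posz k => (h ^+ k)%g
  | Negz k => (h ^- k.+1)%g
  end.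

(* Meant for a finite generating set S of G; the notion does not depend on    *)
(* which one is chosen.                                                       *)
Definition morse_element (R : realType) (G : groupType) (S : seq G)
    (h : G) : Prop :=
  morse_quasi_geodesic (word_metric R S) (expgz h).

(* Main.v *)
(* Let g in H be Morse in G. Give each edge of the Cayley graph of G the      *)
(* weight W if it starts in a neighborhood N of the powers of g, and 1        *)
(* otherwise. Cheapest paths between powers of g are (W, 1)-quasi-geodesics,  *)
(* whatever N is, hence stay in N as soon as N has radius at least M(W, 1);   *)
(* so every path between x and y in <g> costs at least W * d(x, y). On the    *)
(* other hand, balls of G are finite, so an excursion of a quasi-geodesic of  *)
(* H far from <g> in H is far from <g> in G: each of its edges has weight 1,  *)
(* and its cost is at most linear in d(x, y), with a slope not depending on   *)
(* N. Taking W larger than this slope bounds the length of the excursion.     *)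
Require Import Defs.
From mathcomp Require Import all_boot all_order all_algebra.
From mathcomp Require Import all_classical all_reals.
From mathcomp Require Import zify lra.

Set Implicit Arguments.
Unset Strict Implicit.
Unset Printing Implicit Defensive.
Import Order.TTheory GRing.Theory Num.Theory.

(** The contrapositive is [morse_element_subgroup]: an element of [H] that is Morse in [G] is Morse
    in [H]. As [H] may be distorted, a quasi-geodesic of [H] need not be one in [G], so the Morse
    property is applied to cheapest weighted paths instead; it gives the lower bound
    [morse_element_cost]. The inclusion of [H] is Lipschitz ([subgroup_lipschitz]) and proper
    ([subgroup_proper]), which turns an excursion in [H] into a path in [G] whose cost
    [path_cost_chain] bounds above. [subgroup_excursions] compares the two bounds for sequences of
    points, to which [quasi_geodesic_discretization] reduces quasi-geodesics. *)

(** * Integer powers in a group *)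

Section IntegerPowers.
Implicit Types (G : groupType) (m n : int).

Lemma expgz1D G (g : G) n : expgz g (1 + n)%R = (g * expgz g n)%g.
Proof.
case: n => [k|[|k]]; first by rewrite -expgS.
- by rewrite /= expg1 mulgV.
- have -> : (1 + Negz k.+1)%R = Negz k by lia.
  by rewrite /= -!expVgn [in RHS]expgS mulVKg.
Qed.

Lemma expgzD G (g : G) m n : expgz g (m + n)%R = (expgz g m * expgz g n)%g.
Proof.
elim/int_rect: m n => [n|m IH n|m IH n]; first by rewrite add0r mul1g.
- by rewrite -add1n PoszD -addrA !expgz1D IH mulgA.
- apply: (mulgI g); rewrite mulgA -!expgz1D.
  have -> : (1 - m.+1%:Z)%R = (- m%:Z)%R by lia.
  have -> : (1 + (- m.+1%:Z + n))%R = (- m%:Z + n)%R by lia.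
  exact: IH.
Qed.

Lemma expgzVM G (g : G) m n :
  ((expgz g m)^-1 * expgz g n)%g = expgz g (n - m)%R.
Proof.
have -> : n = (m + (n - m))%R by lia.
by rewrite expgzD mulKg; congr (expgz _ _); lia.
Qed.

Lemma val_expgz G (P : pred G) (H : subGroupType P) (h : H) n :
  val (expgz h n) = expgz (val h) n.
Proof. by case: n => k /=; rewrite ?gmulfV gmulfXn. Qed.

End IntegerPowers.

(** * Word lengths and the inclusion of a subgroup *)

Section WordLength.
Implicit Types (G : groupType).

Lemma words_for_cat G (S : seq G) x y u v :
  words_for S x u -> words_for S y v -> words_for S (x * y)%g (u ++ v).
Proof.
by move=> [lu <-] [lv <-]; split; rewrite ?all_cat ?lu ?lv ?big_cat.
Qed.

Lemma words_for_inv G (S : seq G) x u :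
  words_for S x u -> words_for S x^-1%g (rev [seq y^-1%g | y <- u]).
Proof.
move=> [lu <-]; split; last first.
  by rewrite -map_rev big_map prodgV revK.
rewrite all_rev all_map; apply: sub_all lu => y /=.
by rewrite invgK orbC.
Qed.

Lemma words_for_size G (S : seq G) (genS : generates S) x :
  exists n, `[< exists2 w, words_for S x w & size w = n >].
Proof. by have [w ws] := genS x; exists (size w); apply/asboolP; exists w. Qed.

(** Natural-valued, so that the combinatorial estimates stay in [nat]; [word_lengthE] identifies it
    with the real infimum. *)
Definition wlen G (S : seq G) (genS : generates S) (x : G) : nat :=
  ex_minn (words_for_size genS x).

Lemma wlenP G (S : seq G) (genS : generates S) x :
  exists2 w, words_for S x w & size w = wlen genS x.
Proof. by rewrite /wlen; case: ex_minnP => n /asboolP. Qed.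

Lemma wlen_le_size G (S : seq G) (genS : generates S) x w :
  words_for S x w -> wlen genS x <= size w.
Proof.
rewrite /wlen; case: ex_minnP => n _ minn ws.
by apply: minn; apply/asboolP; exists w.
Qed.

Lemma word_lengthE (R : realType) G (S : seq G) (genS : generates S) x :
  word_length R S x = ((wlen genS x)%:R)%R.
Proof.
have [w ws sw] := wlenP genS x; apply/eqP; rewrite eq_le; apply/andP; split.
  apply: ge_inf; last by exists w => //; rewrite sw.
  by exists 0%R => _ [v _ <-].
apply: lb_le_inf; first by exists (size w)%:R%R, w.
by move=> _ [v vs <-]; rewrite ler_nat wlen_le_size.
Qed.

Lemma wlen1 G (S : seq G) (genS : generates S) : wlen genS 1%g = 0.
Proof.
apply/eqP; rewrite -leqn0; apply: (@wlen_le_size _ _ _ _ [::]).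
by split; rewrite ?big_nil.
Qed.

Lemma wlenM G (S : seq G) (genS : generates S) x y :
  wlen genS (x * y)%g <= wlen genS x + wlen genS y.
Proof.
have [u us <-] := wlenP genS x; have [v vs <-] := wlenP genS y.
by rewrite -size_cat; apply/wlen_le_size/words_for_cat.
Qed.

Lemma wlenV G (S : seq G) (genS : generates S) x :
  wlen genS x^-1%g = wlen genS x.
Proof.
suff le y : wlen genS y^-1%g <= wlen genS y.
  by apply/eqP; rewrite eqn_leq le -{1}[x]invgK le.
have [u us <-] := wlenP genS y.
rewrite -[size u](size_map (fun z => z^-1%g)) -size_rev.
exact/wlen_le_size/words_for_inv.
Qed.

Lemma wlenX G (S : seq G) (genS : generates S) x n :
  wlen genS (x ^+ n)%g <= n * wlen genS x.
Proof.
elim: n => [|n IH]; first by rewrite wlen1.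
by rewrite expgS mulSn (leq_trans (wlenM _ _ _)) // leq_add2l.
Qed.

Lemma wlen_expgz G (S : seq G) (genS : generates S) x n :
  wlen genS (expgz x n) <= `|n|%N * wlen genS x.
Proof. by case: n => k; rewrite /= ?wlenV wlenX. Qed.

Definition wdist G (S : seq G) (genS : generates S) (x y : G) : nat :=
  wlen genS (x^-1 * y)%g.

Lemma word_metricE (R : realType) G (S : seq G) (genS : generates S) x y :
  word_metric R S x y = ((wdist genS x y)%:R)%R.
Proof. exact: word_lengthE. Qed.

Lemma wdistC G (S : seq G) (genS : generates S) x y :
  wdist genS x y = wdist genS y x.
Proof. by rewrite /wdist -wlenV invgM invgK. Qed.

Lemma wdist_triangle G (S : seq G) (genS : generates S) y x z :
  wdist genS x z <= wdist genS x y + wdist genS y z.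
Proof. by rewrite /wdist -{1}[z](mulVKg y) mulgA wlenM. Qed.

Lemma finite_balls G (S : seq G) (genS : generates S) n :
  exists B : seq G, forall x, wlen genS x <= n -> x \in B.
Proof.
suff [B HB] : exists B : seq G, forall x w,
    words_for S x w -> size w <= n -> x \in B.
  by exists B => x; have [w ws <-] := wlenP genS x; apply: HB.
elim: n => [|n [B HB]].
  by exists [:: 1%g] => x [|//] [_ <-] _; rewrite big_nil mem_head.
exists (1%g :: [seq (s * x)%g | s <- S ++ [seq s^-1%g | s <- S], x <- B]).
move=> x [|s w] [/= lw <-] sw; first by rewrite big_nil mem_head.
case/andP: lw => ls lw.
rewrite big_cons in_cons; apply/orP; right; apply: allpairs_f.
  rewrite mem_cat; case/orP: ls => ls; first by rewrite ls.
  by rewrite -[s]invgK map_f ?orbT // invgK.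
by apply: HB sw; split.
Qed.

Lemma subgroup_lipschitz G (P : pred G) (H : subGroupType P)
    (S : seq G) (T : seq H) (genS : generates S) (genT : generates T) :
  exists2 K, 0 < K & forall x y : H,
    wdist genS (val x) (val y) <= K * wdist genT x y.
Proof.
pose K := (\sum_(t <- T) wlen genS (val t)).+1.
have KT t : t \in T -> wlen genS (val t) <= K.
  by move=> tT; rewrite /K (big_rem t) //= ltnW // ltnS leq_addr.
exists K => // x y; rewrite /wdist -gmulfV -gmulfM.
have [w [lw <-] <-] := wlenP genT (x^-1 * y)%g.
elim: w lw => [|t w IH] /= lw; first by rewrite big_nil gmulf1 wlen1.
case/andP: lw => lt lw; rewrite big_cons gmulfM mulnS.
apply: leq_trans (wlenM _ _ _) (leq_add _ (IH lw)).
case/orP: lt => lt; first exact: KT.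
by rewrite -[t]invgK gmulfV wlenV KT.
Qed.

(** A ball of [G] contains finitely many elements of [H], so their lengths in [H] are bounded;
    nothing is said of how fast the bound grows with [n]. *)
Lemma subgroup_proper G (P : pred G) (H : subGroupType P)
    (S : seq G) (T : seq H) (genS : generates S) (genT : generates T) n :
  exists r, forall x y : H,
    wdist genS (val x) (val y) <= n -> wdist genT x y <= r.
Proof.
have [B HB] := finite_balls genS n.
exists (\sum_(b <- B) if insub b is Some h then wlen genT h else 0) => x y.
rewrite /wdist -gmulfV -gmulfM => /HB hB.
by rewrite (big_rem _ hB) /= valK leq_addr.
Qed.

End WordLength.

(** * Weighted Cayley graphs and their cheapest paths *)

Section WeightedPaths.
Variables (G : groupType) (N : pred G) (W : nat).
Hypothesis W_gt0 : 0 < W.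
Implicit Types (S : seq G) (x y : G) (u v w : seq G).

Fixpoint path_cost x w : nat :=
  if w is s :: w' then (if N x then W else 1) + path_cost (x * s)%g w' else 0.

Lemma path_cost_cat x u v :
  path_cost x (u ++ v) =
  path_cost x u + path_cost (x * \prod_(s <- u) s)%g v.
Proof.
elim: u x => [|s u IH] x /=; first by rewrite big_nil mulg1.
by rewrite IH big_cons mulgA addnA.
Qed.

Lemma path_cost_le x w : path_cost x w <= W * size w.
Proof.
elim: w x => [|s w IH] x //=.
by rewrite mulnS leq_add // ; case: ifP.
Qed.

Lemma path_cost_ge x w : size w <= path_cost x w.
Proof.
elim: w x => [|s w IH] x //=.
by rewrite -add1n leq_add //; case: ifP.
Qed.

Lemma path_cost_const b x w :
  (forall u v, w = u ++ v -> N (x * \prod_(s <- u) s)%g = b) ->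
  path_cost x w = (if b then W else 1) * size w.
Proof.
elim: w x => [|s w IH] x Nw; first by rewrite muln0.
rewrite /= (IH (x * s)%g).
  by move: (Nw [::] (s :: w) erefl); rewrite big_nil mulg1 => ->; rewrite mulnS.
by move=> u v wuv; rewrite -(Nw (s :: u) v) ?wuv // big_cons mulgA.
Qed.

Definition min_cost_word S x y w :=
  words_for S y w /\
  forall w', words_for S y w' -> path_cost x w <= path_cost x w'.

Lemma min_cost_word_exists S (genS : generates S) x y :
  exists w, min_cost_word S x y w.
Proof.
have ex : exists n, `[< exists2 w, words_for S y w & path_cost x w = n >].
  have [w ws] := genS y.
  by exists (path_cost x w); apply/asboolP; exists w.
case: (ex_minnP ex) => n /asboolP[w ws <-] minw.
exists w; split=> // w' ws'; apply: minw.
by apply/asboolP; exists w'.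
Qed.

(* A geodesic with the endpoints of v costs at most W per step. *)
Lemma min_cost_word_subpath S (genS : generates S) x y u v w :
  min_cost_word S x y (u ++ v ++ w) ->
  size v <= W * wlen genS (\prod_(s <- v) s)%g.
Proof.
case=> -[luvw yuvw] minw.
have [v' [lv' pv'] <-] := wlenP genS (\prod_(s <- v) s)%g.
apply: leq_trans (path_cost_ge (x * \prod_(s <- u) s)%g v) _.
apply: leq_trans _ (path_cost_le (x * \prod_(s <- u) s)%g v').
have := minw (u ++ v' ++ w); rewrite !path_cost_cat pv' leq_add2l leq_add2r.
apply; split; last by rewrite -yuvw !big_cat /= pv'.
by move: luvw; rewrite !all_cat lv' => /and3P[-> _ ->].
Qed.

Lemma min_cost_word_bilipschitz S (genS : generates S) x y w i j :
  min_cost_word S x y w -> i <= j <= size w ->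
  wdist genS (x * \prod_(s <- take i w) s)%g (x * \prod_(s <- take j w) s)%g
    <= j - i <=
  W * wdist genS (x * \prod_(s <- take i w) s)%g
                 (x * \prod_(s <- take j w) s)%g.
Proof.
move=> minw /andP[ij jw].
have wE : w = take i w ++ drop i (take j w) ++ drop j w.
  by rewrite catA -{1}(take_takel w ij) cat_take_drop cat_take_drop.
have sz : size (drop i (take j w)) = j - i by rewrite size_drop size_takel.
rewrite /wdist -[in take j w](cat_take_drop i (take j w)) big_cat /=.
rewrite take_takel // invgM -!mulgA mulKg mulKg -sz.
have := minw; rewrite {1}wE => /(min_cost_word_subpath genS) ->; rewrite andbT.
apply: wlen_le_size; split=> //.
by case: minw => -[]; rewrite {1}wE !all_cat => /and3P[].
Qed.

(** Rounding times down changes [|s - t|] by less than 1, whence the additive constant. The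
    constants do not depend on [N], so [morse_element_cost] can choose [N] after the Morse
    constant. *)
Lemma min_cost_word_quasi_geodesic (R : realType) S (genS : generates S) x y w :
  min_cost_word S x y w ->
  quasi_geodesic (word_metric R S) (W%:R)%R 1%R 0%R ((size w)%:R)%R
    (fun t => x * \prod_(s <- take (Num.trunc t) w) s)%g.
Proof.
move=> minw; split; first exact: ler0n.
move=> s t /=; rewrite !in_itv /= !(word_metricE _ genS).
wlog st : s t / (s <= t)%R.
  move=> wl sI tI; case: (leP s t) => [|/ltW] st; first exact: wl.
  by rewrite distrC wdistC; apply: wl.
move=> /andP[s0 sw] /andP[t0 tw].
have /andP[is1 is2] := truncn_itv s0.
have /andP[it1 it2] := truncn_itv t0.
have ij : Num.trunc s <= Num.trunc t by apply: le_truncn.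
have jw : Num.trunc t <= size w by rewrite -(ler_nat R) (le_trans it1).
have := min_cost_word_bilipschitz genS minw (introT andP (conj ij jw)).
set e := wdist _ _ _ => /andP[].
rewrite -!(ler_nat R) natrM natrB // => le1 le2.
move: is2 it2; rewrite -!natr1 => is2 it2.
have W1 : (1 <= W%:R :> R)%R by rewrite ler1n.
rewrite distrC ger0_norm ?subr_ge0 //; apply/andP; split.
  rewrite lerBlDr mulrC ler_pdivrMr ?ltr0n //; nra.
nra.
Qed.

End WeightedPaths.

(** * Cost of paths between powers of a Morse element *)

Section MorseCost.
Variables (G : groupType) (S : seq G) (genS : generates S) (g : G).

Definition near_powers D : pred G :=
  fun x => `[< exists n, wdist genS x (expgz g n) <= D >].

(* With weight W inside a large enough neighborhood of the powers of g, a     *)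
(* cheapest path between two powers is a quasi-geodesic with constants (W, 1), *)
(* so it never leaves that neighborhood and pays W for each of its steps.      *)
Lemma morse_element_cost (R : realType) W : 0 < W -> morse_element R S g ->
  exists D, forall m n w, words_for S ((expgz g m)^-1 * expgz g n)%g w ->
    W * wdist genS (expgz g m) (expgz g n) <=
    path_cost (near_powers D) W (expgz g m) w.
Proof.
move=> W0 [_ morse].
have [||M HM] := morse (W%:R)%R 1%R; [by rewrite ler1n | exact: ler01 |].
exists (Num.bound M) => m n w ws.
have [v minv] := min_cost_word_exists (near_powers (Num.bound M)) W genS
  (expgz g m) ((expgz g m)^-1 * expgz g n)%g.
apply: leq_trans (minv.2 _ ws).
have qg := min_cost_word_quasi_geodesic W0 R genS minv.
have endv : (expgz g m * \prod_(s <- v) s)%g = expgz g n.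
  by rewrite minv.1.2 mulVKg.
rewrite (@path_cost_const _ _ _ true).
  by rewrite leq_mul2l wlen_le_size ?orbT //; exact: minv.1.
move=> u u' vE; apply/asboolP.
have [|||z [k _ <-]] := HM _ _ _ qg _ _ (expgz g m * \prod_(s <- u) s)%g.
- by exists m => //; rewrite truncn0 take0 big_nil mulg1.
- by exists n => //; rewrite natrK take_size endv.
- exists ((size u)%:R)%R.
    by rewrite /= in_itv /= ler0n ler_nat vE size_cat leq_addr.
  by rewrite natrK vE take_size_cat.
rewrite (word_metricE _ genS) => le_M; exists k.
rewrite -(ler_nat R) (le_trans le_M) // ltW // archi_boundP //.
exact: le_trans (ler0n _ _) le_M.
Qed.

(** Used contrapositively: short words read from a far point stay outside the heavy region. *)
Lemma near_powers_prefix D x u (lu : words_for S (\prod_(s <- u) s)%g u) :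
  near_powers D (x * \prod_(s <- u) s)%g -> near_powers (D + size u) x.
Proof.
move=> /asboolP[n le_D]; apply/asboolP; exists n.
apply: leq_trans (wdist_triangle _ (x * \prod_(s <- u) s)%g _ _) _.
by rewrite addnC leq_add // /wdist mulKg wlen_le_size.
Qed.

End MorseCost.

(** * Sequences of points with bounded steps *)

(** Only the first step may start inside [N], and it costs at most [W * E]. The others follow
    geodesic words outside [N], where the weight is 1. *)
Lemma path_cost_chain (G : groupType) (S : seq G) (genS : generates S) (N : pred G) W E
    (x : nat -> G) n :
  0 < W -> (forall k, k <= n -> wdist genS (x k) (x k.+1) <= E) ->
  (forall k u, 0 < k <= n -> words_for S (\prod_(s <- u) s)%g u ->
    size u <= E -> ~~ N (x k * \prod_(s <- u) s)%g) ->
  exists2 w, words_for S ((x 0)^-1 * x n.+1)%g w &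
             path_cost N W (x 0) w <= W * E + n * E.
Proof.
move=> W0; elim: n => [|n IH] step far.
  have [w ws sw] := wlenP genS ((x 0)^-1 * x 1%N)%g.
  exists w => //; apply: leq_trans (path_cost_le _ W0 _ _) _.
  by rewrite addn0 leq_mul2l sw (step 0) ?orbT.
have [||w ws wc] := IH.
- by move=> k kn; apply/step/leqW.
- by move=> k u /andP[k0 kn]; apply: far; rewrite k0 leqW.
have [v [lv vp] sv] := wlenP genS ((x n.+1)^-1 * x n.+2)%g.
exists (w ++ v).
  have -> : ((x 0)^-1 * x n.+2 = (x 0)^-1 * x n.+1 * ((x n.+1)^-1 * x n.+2))%g.
    by rewrite mulgA mulgK.
  exact: words_for_cat.
have vE : size v <= E by rewrite sv; apply: step.
rewrite path_cost_cat mulSnr addnA leq_add //.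
rewrite ws.2 mulVKg (@path_cost_const _ _ _ false) ?mul1n //.
move=> u u' vuu; apply/negbTE/far; first by rewrite leqnn.
  by split=> //; move: lv; rewrite vuu all_cat => /andP[].
by apply: leq_trans vE; rewrite vuu size_cat leq_addr.
Qed.

Lemma wdist_chain (G : groupType) (S : seq G) (genS : generates S) (x : nat -> G) c i k :
  (forall l, i <= l < i + k -> wdist genS (x l) (x l.+1) <= c) ->
  wdist genS (x i) (x (i + k)) <= c * k.
Proof.
elim: k => [|k IH] step; first by rewrite addn0 /wdist mulVg wlen1.
apply: leq_trans (wdist_triangle _ (x (i + k)) _ _) _.
rewrite mulnS addnC; apply: leq_add; first by rewrite addnS step // leq_addr addnS /=.
by apply: IH => l /andP[il lk]; apply: step; rewrite il addnS ltnS ltnW.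
Qed.

(** * Excursions in the subgroup *)

Section Subgroup.
Variables (G : groupType) (P : pred G) (H : subGroupType P).
Variables (S : seq G) (T : seq H) (genS : generates S) (genT : generates T).
Variable h : H.

(* An excursion of y outside the r-neighborhood of the powers of h is a path  *)
(* in G that is cheap in the sense of [morse_element_cost], of cost at most   *)
(* E times its number of steps up to a constant. As this number is at most    *)
(* c * A times the distance of the powers of h at its ends, up to a constant, *)
(* the weight W = E * c * A + 1 bounds that distance.                         *)
Lemma subgroup_excursions A c :
  (forall W, 0 < W -> exists D, forall m n w,
    words_for S ((expgz (val h) m)^-1 * expgz (val h) n)%g w ->
    W * wdist genS (expgz (val h) m) (expgz (val h) n) <=
    path_cost (near_powers genS (val h) D) W (expgz (val h) m) w) ->
  (forall m n, wdist genT (expgz h m) (expgz h n) <=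
    A * (wdist genS (expgz (val h) m) (expgz (val h) n)).+1) ->
  exists M, forall (N : nat) (y : nat -> H),
    (forall i, i < N -> wdist genT (y i) (y i.+1) <= c) ->
    (forall i j, i <= j <= N -> j - i <= c * (wdist genT (y i) (y j)).+1) ->
    near_powers genT h 0 (y 0) -> near_powers genT h 0 (y N) ->
    forall i, i <= N -> near_powers genT h M (y i).
Proof.
move=> cost_ge undistorted.
have [K K0 lipK] := subgroup_lipschitz genS genT.
pose E := K * c; pose W := (E * c * A).+1.
have [D HD] := cost_ge W isT.
(* The margin [E] keeps a geodesic of [G] from a far point to the next point of the sequence outside
   the [D]-neighborhood. *)
have [r Hr] := subgroup_proper genS genT (D + E).
have near_r z : near_powers genS (val h) (D + E) (val z) ->
    near_powers genT h r z.
  move=> /asboolP[n le_n]; apply/asboolP; exists n.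
  by apply: Hr; rewrite val_expgz.
(* What remains of the upper bound on [W * d] once [W = E * c * A + 1] has absorbed its term
   [E * c * A * d]. *)
pose B := 2 * (W * (K * r)) + W * E + E * c * (2 * r + A + 1).
(* The excursion lasts at most [c * (2 * r + A * B.+1).+1] steps of length at most [c]; its starting
   point is within [r] of a power. *)
exists (c * (c * (2 * r + A * B.+1).+1) + r) => N y step qi y0 yN i0 i0N.
have near0 z : near_powers genT h 0 z -> near_powers genT h r z.
  by move=> /asboolP[n le_n]; apply/asboolP; exists n; apply: leq_trans le_n _.
have [|far0] := boolP (near_powers genT h r (y i0)).
  move=> /asboolP[n le_n]; apply/asboolP; exists n.
  by apply: leq_trans le_n _; apply: leq_addl.
have ex_i : exists i, (i <= i0) && near_powers genT h r (y i).
  by exists 0; rewrite near0.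
have ex_j : exists j, [&& i0 <= j, j <= N & near_powers genT h r (y j)].
  by exists N; rewrite i0N leqnn near0.
have ub_i i : (i <= i0) && near_powers genT h r (y i) -> i <= i0.
  by case/andP.
(* The excursion around [i0] runs from the last near time before it to the first one after it. *)
case: (ex_maxnP ex_i ub_i) => i /andP[ii0 near_i] max_i.
case: (ex_minnP ex_j) => j /and3P[i0j jN near_j] min_j.
have {}ii0 : i < i0.
  by rewrite ltn_neqAle ii0 andbT; apply: contra far0 => /eqP <-.
have {}i0j : i0 < j.
  by rewrite ltn_neqAle i0j andbT; apply: contra far0 => /eqP ->.
have far k : i < k < j -> ~~ near_powers genT h r (y k).
  move=> /andP[ik kj]; apply/negP => near_k; have [ki0|ki0] := leqP k i0.
    by have := max_i k; rewrite ki0 near_k => /(_ isT); lia.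
  have := min_j k; rewrite near_k (ltnW ki0) (leq_trans (ltnW kj) jN).
  by move=> /(_ isT); lia.
move: near_i near_j => /asboolP[m near_m] /asboolP[n near_n].
have [l jE] : exists l, j = (i + l.+1)%N by exists (j - i).-1; lia.
have [||w ws wc] := @path_cost_chain G S genS (near_powers genS (val h) D) W E
    (fun k => val (y (i + k))) l isT.
- move=> k kl; apply: leq_trans (lipK _ _) _.
  by rewrite leq_mul2l addnS step ?orbT //; lia.
- move=> k u kl us uE; apply: contra (far (i + k) _); last by lia.
  move=> /(near_powers_prefix us)/asboolP[q near_q].
  apply: near_r; apply/asboolP; exists q.
  by apply: leq_trans near_q _; rewrite leq_add2l.
rewrite addn0 -jE in ws wc.
have [u us su] := wlenP genS ((expgz (val h) m)^-1 * val (y i))%g.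
have [v vs sv] := wlenP genS ((val (y j))^-1 * expgz (val h) n)%g.
have uK : size u <= K * r.
  rewrite su -val_expgz; apply: leq_trans (lipK _ _) _.
  by rewrite leq_mul2l wdistC near_m orbT.
have vK : size v <= K * r.
  rewrite sv -val_expgz; apply: leq_trans (lipK _ _) _.
  by rewrite leq_mul2l near_n orbT.
(* The excursion is closed up by [u] and [v], each of cost at most [W * (K * r)]. *)
have := HD m n (u ++ w ++ v).
set d := wdist genS _ _ => /(_ _) d_le.
have {}d_le : W * d <= 2 * (W * (K * r)) + (W * E + l * E).
  apply: leq_trans (d_le _) _.
    have -> : ((expgz (val h) m)^-1 * expgz (val h) n =
        (expgz (val h) m)^-1 * val (y i) *
        ((val (y i))^-1 * val (y j) * ((val (y j))^-1 * expgz (val h) n)))%g.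
      by rewrite -!mulgA !mulVKg.
    by apply/words_for_cat => //; apply: words_for_cat.
  rewrite !path_cost_cat us.2 mulVKg ws.2 mulVKg.
  have cu := leq_trans (path_cost_le (near_powers genS (val h) D)
    (isT : 0 < W) (expgz (val h) m) u) (leq_mul (leqnn W) uK).
  have cv := leq_trans (path_cost_le (near_powers genS (val h) D)
    (isT : 0 < W) (val (y j)) v) (leq_mul (leqnn W) vK).
  lia.
have dT_le : wdist genT (y i) (y j) <= 2 * r + A * d.+1.
  have := undistorted m n; rewrite -/d.
  have := wdist_triangle genT (expgz h m) (y i) (y j).
  have := wdist_triangle genT (expgz h n) (expgz h m) (y j).
  rewrite [wdist _ (expgz h n) (y j)]wdistC; lia.
have l_le : l.+1 <= c * (2 * r + A * d.+1).+1.
  have -> : l.+1 = j - i by lia.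
  by apply: leq_trans (qi i j _) _; [lia | rewrite leq_mul2l ltnS dT_le orbT].
have dB : d <= B.
  have lE : l * E <= c * (2 * r + A * d.+1).+1 * E by rewrite leq_mul2r ltnW ?orbT.
  have : W * d <= 2 * (W * (K * r)) + (W * E + c * (2 * r + A * d.+1).+1 * E).
    by apply: leq_trans d_le _; rewrite !leq_add2l.
  rewrite /B; set X := W * (K * r); set Y := W * E; rewrite /W; nia.
apply/asboolP; exists m.
apply: leq_trans (wdist_triangle _ (y i) _ _) (leq_add _ near_m).
rewrite wdistC; have -> : i0 = (i + (i0 - i))%N by lia.
apply: leq_trans (wdist_chain (c := c) _) _.
  by move=> k ki; apply: step; lia.
rewrite leq_mul2l; apply/orP; right.
have : c * (2 * r + A * d.+1).+1 <= c * (2 * r + A * B.+1).+1.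
  by rewrite leq_mul2l ltnS leq_add2l leq_mul2l ltnS dB !orbT.
lia.
Qed.

End Subgroup.

(** * From Morse in the group to Morse in the subgroup *)

Section Main.
Variables (R : realType) (G : groupType) (P : pred G) (H : subGroupType P).
Variables (S : seq G) (T : seq H) (genS : generates S) (genT : generates T).
Variable h : H.
Hypothesis morse_h : morse_element R S (val h).

(** One constant suffices because [L * (d + C) <= L * (1 + C) * (d + 1)]. *)
Lemma morse_powers_undistorted : exists A, forall m n,
  `|m - n|%N <= A * (wdist genS (expgz (val h) m) (expgz (val h) n)).+1.
Proof.
have [[L [C [L1 C0 qi]]] _] := morse_h.
exists (Num.bound (L * (1 + C))%R) => m n.
have /andP[+ _] := qi m n I I; rewrite (word_metricE _ genS).
set d := wdist _ _ _ => le_d.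
have := archi_boundP (mulr_ge0 (le_trans ler01 L1) (addr_ge0 ler01 C0)).
set A := Num.bound _ => A_gt.
have L0 : (0 < L)%R by apply: lt_le_trans L1.
move: le_d; rewrite lerBlDr mulrC ler_pdivrMr // => le_d.
rewrite -(ler_nat R) natrM -natr1.
have -> : (`|m - n|%N%:R = `|m - n|%:~R :> R)%R by rewrite -natr_absz.
have d0 : (0 <= d%:R :> R)%R by exact: ler0n.
apply: le_trans le_d (le_trans _ (ler_wpM2r (addr_ge0 d0 ler01) (ltW A_gt))).
have : (0 <= L * (C * d%:R))%R by rewrite !mulr_ge0 // ltW.
lra.
Qed.

Lemma quasi_geodesic_discretization L C a b (p : R -> H) :
  (1 <= L)%R -> (0 <= C)%R ->
  quasi_geodesic (word_metric R T) L C a b p ->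
  let c := Num.bound (L + C + L * C + 1)%R in
  exists N (y : nat -> H), [/\ y 0 = p a, y N = p b,
    forall i, i < N -> wdist genT (y i) (y i.+1) <= c,
    forall i j, i <= j <= N -> j - i <= c * (wdist genT (y i) (y j)).+1 &
    forall t, t \in `[a, b]%R ->
      exists2 i, i <= N & wdist genT (p t) (y i) <= c].
Proof.
move=> L1 C0 [ab qi] c.
have c_gt : (L + C + L * C + 1 < c%:R)%R.
  by apply: archi_boundP; nra.
have L0 : (0 < L)%R by apply: lt_le_trans L1.
pose N := (Num.trunc (b - a)%R).+1.
(* Unit steps from [a], clipped at [b]: up to index [N] only the last step can be shorter, whence
   the [- 1] in [le_s]. *)
pose s i := Num.min (a + i%:R)%R b.
have sI i : `[a, b]%classic (s i).
  by rewrite /= in_itv /= le_min ab lerDl ler0n ge_min lexx orbT.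
have ba0 : (0 <= b - a)%R by rewrite subr_ge0.
have /andP[N1 N2] := truncn_itv ba0.
have dist_le u v : `[a, b]%classic u -> `[a, b]%classic v ->
    (`|u - v| <= 1)%R -> wdist genT (p u) (p v) <= c.
  move=> uI vI uv; have /andP[_] := qi u v uI vI.
  rewrite (word_metricE _ genT) -(ler_nat R) => le_d; nra.
exists N, (p \o s); split=> /=.
- by rewrite /s addr0 min_l.
- by rewrite /s min_r // -lerBlDl ltW.
- move=> i _; apply: dist_le => //; rewrite /s -natr1.
  by rewrite ler_norml; case: (leP (a + i%:R)%R b) => ?;
    case: (leP (a + (i%:R + 1))%R b) => ?; lra.
- move=> i j /andP[ij jN].
  have /andP[+ _] := qi _ _ (sI i) (sI j); rewrite (word_metricE _ genT).
  set d := wdist _ _ _; rewrite lerBlDr mulrC ler_pdivrMr // => le_d.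
  have le_s : (j%:R - i%:R - 1 <= `|s i - s j|)%R.
    rewrite distrC; apply: le_trans (ler_norm _).
    move: jN; rewrite -(ler_nat R) /N -natr1 => jN.
    have := ij; rewrite -(ler_nat R) => ij'.
    by rewrite /s; case: (leP (a + i%:R)%R b) => ?;
      case: (leP (a + j%:R)%R b) => ?; lra.
  rewrite -(ler_nat R) natrB // natrM -natr1.
  have d0 : (0 <= d%:R :> R)%R by exact: ler0n.
  apply: le_trans (ler_wpM2r (addr_ge0 d0 ler01) (ltW c_gt)).
  have : (0 <= (C + L * C + 1) * d%:R)%R.
    by rewrite mulr_ge0 // !addr_ge0 // mulr_ge0 // ltW.
  by move: le_s le_d; lra.
- move=> t tI; have := tI; rewrite in_itv /= => /andP[at_ tb].
  have ta0 : (0 <= t - a)%R by rewrite subr_ge0.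
  have /andP[i1 i2] := truncn_itv ta0.
  exists (Num.trunc (t - a)%R); first by apply/leqW/le_truncn; rewrite lerD2r.
  apply: dist_le => //; rewrite /s min_l; last lra.
  by move: i2; rewrite -natr1 ler_norml => i2; lra.
Qed.

Lemma morse_element_subgroup : morse_element R T h.
Proof.
have [A HA] := morse_powers_undistorted.
have [K K0 lipK] := subgroup_lipschitz genS genT.
pose t := wlen genT h.
have le_t m n : wdist genT (expgz h m) (expgz h n) <= `|m - n|%N * t.
  by rewrite /wdist expgzVM (leq_trans (wlen_expgz _ _ _)) // distnC.
split.
  (* [A * K] serves the lower bound, through distances in [G], and [t] the upper bound. *)
  pose b := (A * K + t).+1.
  have b0 : (0 < b%:R :> R)%R by rewrite ltr0n.
  exists b%:R%R, b%:R%R; split; rewrite ?ler0n ?ler1n // => m n _ _.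
  rewrite (word_metricE _ genT).
  have -> : (`|m - n|%:~R = `|m - n|%N%:R :> R)%R by rewrite -natr_absz.
  rewrite lerBlDr mulrC ler_pdivrMr // -natrD -!natrM -natrD !ler_nat.
  have := le_t m n; have := HA m n.
  have := lipK (expgz h m) (expgz h n); rewrite !val_expgz.
  set dS := wdist genS _ _; set dT := wdist genT _ _; set k := `|m - n|%N.
  rewrite /b => ? ? ?; apply/andP; split; nia.
move=> L C L1 C0; set c := Num.bound (L + C + L * C + 1)%R.
have [|m n|M HM] := @subgroup_excursions G P H S T genS genT h (t * A) c.
- by move=> W W0; apply: morse_element_cost morse_h.
- apply: leq_trans (le_t m n) _.
  by rewrite mulnC -mulnA leq_mul2l HA orbT.
(* [c] reaches a sample point, and [M] goes from there to a power of [h]. *)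
exists (c + M)%:R%R => a b p qg [m _ pa] [n _ pb] _ [u uI <-].
have [N [y [y0 yN step qi close]]] := quasi_geodesic_discretization L1 C0 qg.
have [i iN pu] := close u uI.
have near0 z k : expgz h k = z -> near_powers genT h 0 z.
  by move=> <-; apply/asboolP; exists k; rewrite /wdist mulVg wlen1.
have /asboolP[k near_k] : near_powers genT h M (y i).
  by apply: HM step qi _ _ _ iN; [rewrite y0 | rewrite yN]; apply: near0; eassumption.
exists (expgz h k); first by exists k.
rewrite (word_metricE _ genT) ler_nat.
exact: leq_trans (wdist_triangle _ (y i) _ _) (leq_add pu near_k).
Qed.

End Main.

Theorem proposition1p2 (R : realType) (G : groupType) (P : pred G)
    (H : subGroupType P) (S : seq G) (T : seq H)
    (genS : generates S) (genT : generates T) :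
  (forall h : H, ~ morse_element R T h) ->
  forall g : G, g \in P -> ~ morse_element R S g.
Proof.
move=> no_morse g gP morse_g; apply: (no_morse (Sub g gP)).
by apply: (morse_element_subgroup genS genT); rewrite SubK.
Qed.
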